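(* Let $\lambda\in\mathbb{Z}$ and let $A_\lambda=\bigoplus_{n\ge0}\mathbb{Z}\,\mathfrak{a}_n$ be the Rota-Baxter ring of weight $\lambda$ described in the context. Let $I$ be a Rota-Baxter ideal of $A_\lambda$. Then there exist a positive integer $m$ and $m$ pairs $(s_1,\omega_1),\dots,(s_m,\omega_m)$, with each $s_j$ a nonnegative integer and each $\omega_j$ a positive integer, such that $s_j<s_{j+1}$, $\omega_{j+1}\ne\omega_j$ and $\omega_{j+1}\mid\omega_j$ for $1\le j\le m-1$, and $$A(I)=\{(s_1,\omega_1\mathbb{Z}),\dots,(s_m,\omega_m\mathbb{Z})\}.$$ Thus, with the convention that $s_0=0$, $\omega_0=0$ and $s_{m+1}=\infty$: if $I$ is homogeneous, then $$I=\bigoplus_{j=1}^m\ \bigoplus_{i=s_j}^{s_{j+1}-1}\omega_j\mathbb{Z}\,\mathfrak{a}_i$$ and the quotient $A_\lambda/I$ is isomorphic to $$\bigoplus_{j=0}^m\ \bigoplus_{i=s_j}^{s_{j+1}-1}\mathbb{Z}_{\omega_j}\,\mathfrak{a}_i;\qquad(\ast)$$ if $I$ is nonhomogeneous, then $A_\lambda/I$ has the same underlying set as $A_\lambda/\mathrm{in}(I)$, as given in $(\ast)$. Conversely, for any positive integer $m$ and $m$ pairs $(s_1,\omega_1),\dots,(s_m,\omega_m)$ of a nonnegative integer $s_j$ and a positive integer $\omega_j$ with $s_j<s_{j+1}$, $\omega_{j+1}\ne\omega_j$ and $\omega_{j+1}\mid\omega_j$ for $1\le j\le m-1$, there is a Rota-Baxter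 ideal $I$ of $A_\lambda$ such that the underlying set of $A_\lambda/I$ is that of $(\ast)$.
   Context: The ring $A_\lambda$: as an abelian group it is free on the basis $\{\mathfrak{a}_n\mid n\ge 0\}$; the product is the bilinear product determined by $$\mathfrak{a}_p\mathfrak{a}_q=\sum_{i=0}^{\min(p,q)}\binom{p+q-i}{p}\binom{p}{i}\lambda^i\,\mathfrak{a}_{p+q-i},\qquad p,q\ge 0,$$ with identity $\mathfrak{a}_0$; it carries the additive operator $P$ with $P(\mathfrak{a}_n)=\mathfrak{a}_{n+1}$ for $n\ge 0$, and $(A_\lambda,P)$ is a Rota-Baxter ring of weight $\lambda$, i.e. $P(x)P(y)=P(xP(y))+P(P(x)y)+\lambda P(xy)$ for all $x,y$. A Rota-Baxter ideal of $A_\lambda$ is an ideal $I$ with $P(I)\subseteq I$; the Rota-Baxter ideal generated by a subset is the smallest Rota-Baxter ideal containing it. A homogeneous Rota-Baxter ideal is one generated, as a Rota-Baxter ideal, by homogeneous elements, i.e. elements of the form $b\,\mathfrak{a}_n$, $b\in\mathbb{Z}$. For nonzero $f=\sum_{i=0}^n c_i\mathfrak{a}_i$ with $c_n\ne 0$, the initial term of $f$ is $\mathrm{in}(f)=c_n\mathfrak{a}_n$. The initial Rota-Baxter ideal $\mathrm{in}(I)$ is the Rota-Baxter ideal generated by the initial terms $\mathrm{in}(f)$ of the nonzero elements $f\in I$. Ascent set: for a Rota-Baxter ideal $I$ and $j\ge 0$, let $\Omega_j=\{0\}\cup\{b\in\mathbb{Z}\mid \exists f\in I,\ \mathrm{in}(f)=b\,\mathfrak{a}_j\}$;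 these are ideals of $\mathbb{Z}$ with $\Omega_j\subseteq\Omega_{j+1}$. Put $\Omega_{-1}=\{0\}$ and let $s_1<s_2<\cdots$ be the integers $t\ge 0$ with $\Omega_{t-1}\subsetneq\Omega_t$. The ascent set $A(I)$ is the set of all pairs $(s_j,\Omega_{s_j})$. $\mathbb{Z}_n=\mathbb{Z}/n\mathbb{Z}$ for $n\ge1$ and $\mathbb{Z}_0=\mathbb{Z}$. An upper limit $s_{m+1}-1$ with $s_{m+1}=\infty$ means that $i$ runs over all integers $\ge s_m$. That $A_\lambda/I$ has underlying set $(\ast)$ means: for any choice of complete sets $T_j\subseteq\mathbb{Z}$ of representatives of $\mathbb{Z}$ modulo $\omega_j\mathbb{Z}$ with $0\in T_j$ ($0\le j\le m$), the set of all finite sums $\sum_i t_i\mathfrak{a}_i$ with $t_i\in T_j$ whenever $s_j\le i<s_{j+1}$ contains exactly one element of each coset of $I$ in $A_\lambda$ (a statement about sets, not about group structures).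
   Formalization: In the first part the Rota-Baxter ideal I is assumed nonzero: for I = 0 every Ω_j is {0}, so A(I) is empty and no positive integer m with the stated pairs exists. *)

(* Defs.v *)
From HB Require Import structures.
From mathcomp Require Import all_boot all_order all_algebra.
From mathcomp Require Import ssrAC zify ring generic_quotient ring_quotient.
From mathcomp Require Import all_classical.

Set Implicit Arguments.
Unset Strict Implicit.
Unset Printing Implicit Defensive.

Import GRing.Theory.
Local Open Scope classical_set_scope.
Local Open Scope ring_scope.
Local Open Scope quotient_scope.

(* The carrier of A_lambda is the additive group of {poly int}, the monomial  *)
(* 'X^n standing for the basis element a_n.  The product of {poly int} is NOT *)
(* the product of A_lambda: at type rbring lambda, 1 and * denote the         *)
(* instance declared below from rb_mul.                                       *)
Definition rbring (lambda : int) : Type := {poly int}.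

HB.instance Definition _ (lambda : int) :=
  GRing.Zmodule.copy (rbring lambda) {poly int}.

Section RotaBaxterRing.
Variable lambda : int.
Local Notation A := (rbring lambda).

Definition basis (n : nat) : A := 'X^n : {poly int}.

Definition rb_coef (f : A) (i : nat) : int := (f : {poly int})`_i.

Definition basis_mul (p q : nat) : A :=
  \sum_(i < (minn p q).+1)
     basis (p + q - i) *~ (('C(p + q - i, p) * 'C(p, i))%:Z * lambda ^+ i).

Definition rb_mul (f g : A) : A :=
  \sum_(p < size (f : {poly int})) \sum_(q < size (g : {poly int}))
     basis_mul p q *~ (rb_coef f p * rb_coef g q).

(* The additive map a_n |-> a_(n+1); the product here is that of {poly int}.  *)
Definition rbP (f : A) : A := 'X * (f : {poly int}).

Lemma rbP_basis n : rbP (basis n) = basis n.+1.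
Proof. by rewrite /rbP /basis exprS. Qed.

Lemma rbP_is_zmod_morphism : zmod_morphism rbP.
Proof. by move=> f g; rewrite /rbP; exact: mulrBr. Qed.

HB.instance Definition _ := GRing.isZmodMorphism.Build A A rbP
  rbP_is_zmod_morphism.

Lemma rb_coefD f g i : rb_coef (f + g) i = rb_coef f i + rb_coef g i.
Proof. exact: coefD. Qed.

Lemma rb_coef_basis n i : rb_coef (basis n) i = (i == n)%:R.
Proof. exact: coefXn. Qed.

Lemma rb_mulEw n m (f g : A) : (size (f : {poly int}) <= n)%N ->
  (size (g : {poly int}) <= m)%N ->
  rb_mul f g = \sum_(p < n) \sum_(q < m) basis_mul p q *~ (rb_coef f p * rb_coef g q).
Proof.
move=> fn gm; rewrite /rb_mul.
under eq_bigr => p _.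
  rewrite (big_ord_widen m (fun q => basis_mul p q *~ (rb_coef f p * rb_coef g q))) //.
  rewrite big_mkcond /=.
  under eq_bigr => q _.
    have -> : (if (q < size (g : {poly int}))%N
      then basis_mul p q *~ (rb_coef f p * rb_coef g q) else 0) =
      basis_mul p q *~ (rb_coef f p * rb_coef g q).
      by case: ltnP => // h; rewrite {2}/rb_coef nth_default // mulr0.
    over.
  over.
rewrite (big_ord_widen n (fun p => \sum_(q < m)
  basis_mul p q *~ (rb_coef f p * rb_coef g q))) // big_mkcond /=.
apply: eq_bigr => p _; case: ltnP => // h.
by rewrite big1 // => q _; rewrite {1}/rb_coef nth_default // mul0r.
Qed.

Lemma rb_mulDl : left_distributive rb_mul +%R.
Proof.
move=> f g h.
set n := maxn (size (f : {poly int})) (size (g : {poly int})).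
rewrite !(@rb_mulEw n (size (h : {poly int}))) ?leq_maxl ?leq_maxr //;
  last by rewrite /n; exact: size_polyD.
rewrite -big_split /=; apply: eq_bigr => p _.
rewrite -big_split /=; apply: eq_bigr => q _.
by rewrite rb_coefD mulrDl mulrzDr.
Qed.

Lemma rb_mulDr : right_distributive rb_mul +%R.
Proof.
move=> h f g.
set n := maxn (size (f : {poly int})) (size (g : {poly int})).
rewrite !(@rb_mulEw (size (h : {poly int})) n) ?leq_maxl ?leq_maxr //;
  last by rewrite /n; exact: size_polyD.
rewrite -big_split /=; apply: eq_bigr => p _.
rewrite -big_split /=; apply: eq_bigr => q _.
by rewrite rb_coefD mulrDr mulrzDr.
Qed.

Lemma rb_mul0l g : rb_mul 0 g = 0.
Proof. by apply: (addrI (rb_mul 0 g)); rewrite -rb_mulDl !addr0. Qed.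

Lemma rb_mul0r g : rb_mul g 0 = 0.
Proof. by apply: (addrI (rb_mul g 0)); rewrite -rb_mulDr !addr0. Qed.

Lemma rb_mulNl f g : rb_mul (- f) g = - rb_mul f g.
Proof.
by apply: (addrI (rb_mul f g)); rewrite -rb_mulDl !subrr rb_mul0l.
Qed.

Lemma rb_mulNr f g : rb_mul f (- g) = - rb_mul f g.
Proof.
by apply: (addrI (rb_mul f g)); rewrite -rb_mulDr !subrr rb_mul0r.
Qed.

Lemma rb_mulMzl f g z : rb_mul (f *~ z) g = rb_mul f g *~ z.
Proof.
have H n : rb_mul (f *+ n) g = rb_mul f g *+ n.
  by elim: n => [|n IH]; rewrite ?rb_mul0l // !mulrS rb_mulDl IH.
by case: z => n; rewrite ?NegzE ?mulrNz ?rb_mulNl -!pmulrn H.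
Qed.

Lemma rb_mulMzr f g z : rb_mul f (g *~ z) = rb_mul f g *~ z.
Proof.
have H n : rb_mul f (g *+ n) = rb_mul f g *+ n.
  by elim: n => [|n IH]; rewrite ?rb_mul0r // !mulrS rb_mulDr IH.
by case: z => n; rewrite ?NegzE ?mulrNz ?rb_mulNr -!pmulrn H.
Qed.

Lemma rb_mul_basis p q : rb_mul (basis p) (basis q) = basis_mul p q.
Proof.
rewrite (@rb_mulEw p.+1 q.+1) ?size_polyXn //.
rewrite big_ord_recr /= big1 => [|i _]; last first.
  by apply: big1 => j _; rewrite rb_coef_basis ltn_eqF // mul0r.
rewrite add0r big_ord_recr /= big1 => [|i _]; last first.
  by rewrite !rb_coef_basis (ltn_eqF (ltn_ord i)) mulr0.
by rewrite add0r !rb_coef_basis !eqxx mulr1.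
Qed.

Lemma basisE (f : A) :
  f = \sum_(p < size (f : {poly int})) basis p *~ rb_coef f p.
Proof.
have H : (f : {poly int}) = \poly_(i < size (f : {poly int})) rb_coef f i.
  by symmetry; exact: coefK.
apply: (etrans H); rewrite poly_def; apply: eq_bigr => i _.
by rewrite -mul_polyC -[in LHS](intz (rb_coef f i)) rmorph_int mulrzl.
Qed.

Lemma basis_ind (K : A -> Prop) : K 0 -> (forall f g, K f -> K g -> K (f + g)) ->
  (forall f, K f -> K (- f)) -> (forall n, K (basis n)) -> forall f, K f.
Proof.
move=> K0 KD KN Kb f; rewrite (basisE f); apply: big_ind => // i _.
have H n : K (basis i *+ n).
  by elim: n => // n IH; rewrite mulrS; apply: KD.
by case: (rb_coef f i) => n; rewrite ?NegzE ?mulrNz -pmulrn //; apply: KN.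
Qed.

Lemma basis_mulEw n p q : (minn p q <= n)%N -> basis_mul p q =
  \sum_(i < n.+1)
     basis (p + q - i) *~ (('C(p + q - i, p) * 'C(p, i))%:Z * lambda ^+ i).
Proof.
move=> le_n; rewrite /basis_mul.
rewrite (big_ord_widen n.+1 (fun i => basis (p + q - i) *~
  (('C(p + q - i, p) * 'C(p, i))%:Z * lambda ^+ i))) //.
rewrite big_mkcond; apply: eq_bigr => i _; case: ltnP => // h.
have [lt_pi|le_ip] := ltnP p i; first by rewrite (bin_small lt_pi) muln0 mul0r.
have lt_qi : (q < i)%N by move: h; rewrite gtn_min [(p < i)%N]ltnNge le_ip.
by rewrite bin_small ?mul0n ?mul0r // ltn_subLR ?(leq_trans le_ip) ?leq_addr //
  addnC ltn_add2r.
Qed.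

Lemma basis_mul0l q : basis_mul 0 q = basis q.
Proof.
by rewrite /basis_mul min0n big_ord1 subn0 add0n !bin0 muln1 mulr1.
Qed.

Lemma basis_mul0r p : basis_mul p 0 = basis p.
Proof.
by rewrite /basis_mul minn0 big_ord1 subn0 addn0 binn bin0 muln1 mulr1.
Qed.

Lemma rbP_Mz f z : rbP (f *~ z) = rbP f *~ z.
Proof. exact: raddfMz. Qed.

Lemma basis_mulSS p q : basis_mul p.+1 q.+1 =
  rbP (basis_mul p q.+1 + basis_mul p.+1 q + basis_mul p q *~ lambda).
Proof.
rewrite (@basis_mulEw p.+1 p.+1 q.+1) ?geq_minl //.
rewrite (@basis_mulEw p.+1 p q.+1); last by rewrite geq_min leqnSn.
rewrite (@basis_mulEw p.+1 p.+1 q) ?geq_minl //.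
rewrite (@basis_mulEw p p q) ?geq_minl //.
rewrite !raddfD /= !rbP_Mz !raddf_sum /=.
have -> : (\sum_(i < p.+1) rbP (basis (p + q - i) *~
   (('C(p + q - i, p) * 'C(p, i))%:Z * lambda ^+ i))) *~ lambda =
   \sum_(i < p.+2) (if i == 0 :> nat then 0 else basis (p.+1 + q.+1 - i) *~
     (('C(p + q.+1 - i, p) * 'C(p, i.-1))%:Z * lambda ^+ i)).
  rewrite [RHS]big_ord_recl /= add0r mulrz_suml; apply: eq_bigr => i _ /=.
  rewrite rbP_Mz rbP_basis -mulrzA /bump /= add1n.
  have le_ip : (i <= p)%N by rewrite -ltnS.
  have -> : (p + q.+1 - i.+1 = p + q - i)%N by rewrite addnS subSS.
  have -> : (p.+1 + q.+1 - i.+1 = (p + q - i).+1)%N.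
    by rewrite addnS subSS addSn subSn // (leq_trans le_ip) ?leq_addr.
  by rewrite exprSr mulrA.
rewrite -!big_split /=; apply: eq_bigr => i _; rewrite !rbP_Mz !rbP_basis.
have le_ip : (i <= p.+1)%N by rewrite -ltnS.
have le_im : (i <= p + q.+1)%N by rewrite addnS -addSn (leq_trans le_ip) ?leq_addr.
have e1 : (p.+1 + q.+1 - i = (p + q.+1 - i).+1)%N by rewrite addSn subSn.
rewrite (addSnnS p q) e1; set m := (p + q.+1 - i)%N.
case: eqVneq => [i0|i0].
  rewrite i0 !bin0 !muln1 expr0 !mulr1 addr0 -mulrzDr -PoszD.
  by rewrite binS addnC.
rewrite -!mulrzDr; congr (_ *~ _); rewrite -!mulrDl; congr (_ * _).
rewrite -!PoszD; congr Posz.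
case: (nat_of_ord i) i0 => // k _ /=.
by rewrite !binS mulnDl !mulnDr -!addnA; ring.
Qed.

Lemma basis_mulC p q : basis_mul p q = basis_mul q p.
Proof.
have [n] := ubnP (p + q); elim: n p q => // n IH [|p] [|q] //;
  rewrite ?basis_mul0l ?basis_mul0r // ltnS => h.
rewrite !basis_mulSS (IH p q.+1); last first.
  by apply: leq_trans h; rewrite addSn.
rewrite (IH p.+1 q); last by apply: leq_trans h; rewrite addnS.
rewrite (IH p q) ?[basis_mul q.+1 p + _]addrC //.
by apply: leq_trans h; rewrite addSn addnS ltnS leqnSn.
Qed.

Lemma rb_mulC : commutative rb_mul.
Proof.
move=> f g; elim/basis_ind: f => [|f f' Hf Hf'|f Hf|p].
- by rewrite rb_mul0l rb_mul0r.
- by rewrite rb_mulDl rb_mulDr Hf Hf'.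
- by rewrite rb_mulNl rb_mulNr Hf.
elim/basis_ind: g => [|f f' Hf Hf'|f Hf|q].
- by rewrite rb_mul0l rb_mul0r.
- by rewrite rb_mulDl rb_mulDr Hf Hf'.
- by rewrite rb_mulNl rb_mulNr Hf.
by rewrite !rb_mul_basis basis_mulC.
Qed.

Lemma rb_mul1l : left_id (basis 0) rb_mul.
Proof.
move=> g; elim/basis_ind: g => [|f f' Hf Hf'|f Hf|q].
- by rewrite rb_mul0r.
- by rewrite rb_mulDr Hf Hf'.
- by rewrite rb_mulNr Hf.
by rewrite rb_mul_basis basis_mul0l.
Qed.

Lemma rb_mulP f g : rb_mul (rbP f) (rbP g) =
  rbP (rb_mul f (rbP g) + rb_mul (rbP f) g + rb_mul f g *~ lambda).
Proof.
elim/basis_ind: f => [|f f' Hf Hf'|f Hf|p].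
- by rewrite !raddf0 !rb_mul0l mul0rz !addr0 raddf0.
- rewrite [rbP (f + f')]raddfD /= !rb_mulDl Hf Hf' -raddfD /= mulrzDl; congr rbP.
  by rewrite addrACA; congr (_ + _); rewrite addrACA.
- by rewrite [rbP (- f)]raddfN /= !rb_mulNl Hf -raddfN /= !opprD mulNrz.
elim/basis_ind: g => [|f f' Hf Hf'|f Hf|q].
- by rewrite !raddf0 !rb_mul0r mul0rz !addr0 raddf0.
- rewrite [rbP (f + f')]raddfD /= !rb_mulDr Hf Hf' -raddfD /= mulrzDl; congr rbP.
  by rewrite addrACA; congr (_ + _); rewrite addrACA.
- by rewrite [rbP (- f)]raddfN /= !rb_mulNr Hf -raddfN /= !opprD mulNrz.
by rewrite !rbP_basis !rb_mul_basis basis_mulSS.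
Qed.

Lemma basis_mulA p q r : rb_mul (basis p) (rb_mul (basis q) (basis r)) =
  rb_mul (rb_mul (basis p) (basis q)) (basis r).
Proof.
have [n] := ubnP (p + q + r); elim: n p q r => // n IH [|p] [|q] [|r];
  rewrite ?rb_mul1l ?[rb_mul _ (basis 0)]rb_mulC ?rb_mul1l //.
rewrite ltnS => h.
have h1 : (p + q.+1 + r.+1 < n)%N by lia.
have h2 : (p.+1 + q + r.+1 < n)%N by lia.
have h3 : (p.+1 + q.+1 + r < n)%N by lia.
have h4 : (p + q + r.+1 < n)%N by lia.
have h5 : (p + q.+1 + r < n)%N by lia.
have h6 : (p.+1 + q + r < n)%N by lia.
have h7 : (p + q + r < n)%N by lia.
move: (IH _ _ _ h1) (IH _ _ _ h2) (IH _ _ _ h3) (IH _ _ _ h4) (IH _ _ _ h5)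
  (IH _ _ _ h6) (IH _ _ _ h7).
rewrite -!rbP_basis; set x := basis p; set y := basis q; set z := basis r.
move=> E1 E2 E3 E4 E5 E6 E7.
have Exy := rb_mulP x y; have Eyz := rb_mulP y z.
rewrite Eyz [LHS]rb_mulP -Eyz Exy [RHS]rb_mulP -Exy; congr rbP.
rewrite !(rb_mulDl, rb_mulDr, rb_mulMzl, rb_mulMzr, mulrzDl).
rewrite E1 E2 E3 E4 E5 E6 E7.
by rewrite !addrA [LHS](ACl (1 * 2 * 5 * 3 * 6 * 4 * 7)%AC).
Qed.

Lemma rb_mulA : associative rb_mul.
Proof.
move=> f g h; elim/basis_ind: f => [|f f' Hf Hf'|f Hf|p].
- by rewrite !rb_mul0l.
- by rewrite !rb_mulDl Hf Hf'.
- by rewrite !rb_mulNl Hf.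
elim/basis_ind: g => [|f f' Hf Hf'|f Hf|q].
- by rewrite !(rb_mul0l, rb_mul0r).
- by rewrite !(rb_mulDl, rb_mulDr) Hf Hf'.
- by rewrite !(rb_mulNl, rb_mulNr) Hf.
elim/basis_ind: h => [|f f' Hf Hf'|f Hf|r].
- by rewrite !rb_mul0r.
- by rewrite !rb_mulDr Hf Hf'.
- by rewrite !rb_mulNr Hf.
exact: basis_mulA.
Qed.

Lemma basis0_neq0 : basis 0 != 0.
Proof. by apply: (@oner_neq0 {poly int}). Qed.

HB.instance Definition _ := GRing.Zmodule_isComNzRing.Build A
  rb_mulA rb_mulC rb_mul1l rb_mulDl basis0_neq0.

Lemma rbring_mulE p q : basis p * basis q = basis_mul p q.
Proof. exact: rb_mul_basis. Qed.

Lemma rota_baxter (x y : A) :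
  rbP x * rbP y = rbP (x * rbP y) + rbP (rbP x * y) + rbP (x * y) *~ lambda.
Proof. by rewrite -rbP_Mz -!raddfD; exact: rb_mulP. Qed.

End RotaBaxterRing.

Section Ideals.
Variable lambda : int.
Local Notation A := (rbring lambda).

Definition rb_ideal (I : set A) : Prop :=
  [/\ I 0, forall f g, I f -> I g -> I (f - g),
      forall f g, I g -> I (f * g) & forall f, I f -> I (rbP f)].

Definition rb_generated (X : set A) : set A :=
  [set f | forall J : set A, rb_ideal J -> X `<=` J -> J f].

Lemma rb_generated_ideal X : rb_ideal (rb_generated X).
Proof.
split=> [J [] //|f g If Ig J hJ XJ|f g Ig J hJ XJ|f If J hJ XJ].
- by case: (hJ) => _ hB _ _; apply: hB; [exact: If|exact: Ig].
- by case: (hJ) => _ _ hM _; apply: hM; exact: Ig.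
- by case: (hJ) => _ _ _ hP; apply: hP; exact: If.
Qed.

Lemma sub_rb_generated X : X `<=` rb_generated X.
Proof. by move=> f Xf J _; apply. Qed.

Definition homogeneous (I : set A) : Prop :=
  exists X : set A, (forall f, X f -> exists (b : int) n, f = basis lambda n *~ b)
    /\ I = rb_generated X.

(* For f <> 0, size f is one more than the largest index occurring in f.      *)
Definition initial (f : A) : A :=
  let n := (size (f : {poly int})).-1 in basis lambda n *~ rb_coef f n.

Definition initial_ideal (I : set A) : set A :=
  rb_generated [set initial f | f in [set f | I f /\ f <> 0]].

Definition Omega (I : set A) (j : nat) : set int :=
  [set b | b = 0 \/
     exists f, [/\ I f, f <> 0 & initial f = basis lambda j *~ b]].

Definition Omega_pred (I : set A) (t : nat) : set int :=
  if t is t'.+1 then Omega I t' else [set 0].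

Definition ascent_set (I : set A) : set (nat * set int) :=
  [set (t, Omega I t) | t in [set t | Omega_pred I t `<` Omega I t]].

Definition rb_ideal_pred (I : set A) of rb_ideal I : {pred A} :=
  fun f => `[< I f >].

Lemma rb_ideal_zmod_closed (I : set A) (hI : rb_ideal I) :
  zmod_closed (rb_ideal_pred hI).
Proof.
have [I0 IB _ _] := hI; split=> [|f g]; rewrite !unfold_in; first exact/asboolP.
by move=> /asboolP If /asboolP Ig; apply/asboolP/IB.
Qed.

HB.instance Definition _ (I : set A) (hI : rb_ideal I) :=
  GRing.isZmodClosed.Build A (rb_ideal_pred hI) (rb_ideal_zmod_closed hI).

(* MathComp's ideal quotients require a proper ideal, whereas I = A_lambda is *)
(* allowed here: only the additive quotient is taken from the library, and    *)
(* its product and operator are recovered as those making the class map       *)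
(* \pi_(rb_quot hI) multiplicative and compatible with rbP.                   *)
Definition rb_quot (I : set A) (hI : rb_ideal I) : Type :=
  {ideal_quot (rb_ideal_pred hI)}.

End Ideals.

(* Z / nZ for every n, including Zmod 0 = Z and the trivial group Zmod 1,     *)
(* which 'Z_n does not provide.                                               *)
Definition Zmod (n : nat) : Type :=
  {ideal_quot (dvdz n%:Z : {pred int})}.

Section DirectSum.
Variable G : nat -> zmodType.

Definition finite_support (u : forall i, G i) : bool :=
  `[< exists n : nat, forall i, (n <= i)%N -> u i = 0 >].

Record direct_sum : Type := DirectSum {
  component :> forall i, G i;
  _ : finite_support component }.

HB.instance Definition _ := [isSub for component].
HB.instance Definition _ := [Choice of direct_sum by <:].

Lemma direct_sumP (u v : direct_sum) : (forall i, u i = v i) -> u = v.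
Proof. by move=> e; apply/val_inj/functional_extensionality_dep. Qed.

Fact zero_support : finite_support (fun i => 0).
Proof. by apply/asboolP; exists 0%N. Qed.

Fact opp_support (u : direct_sum) : finite_support (fun i => - u i).
Proof.
case: u => u /= /asboolP[n un]; apply/asboolP; exists n => i /un ->.
exact: oppr0.
Qed.

Fact add_support (u v : direct_sum) : finite_support (fun i => u i + v i).
Proof.
case: u v => [u /= /asboolP[n un]] [v /= /asboolP[m vm]].
apply/asboolP; exists (maxn n m) => i; rewrite geq_max => /andP[/un -> /vm ->].
exact: addr0.
Qed.

Definition direct_sum_zero := DirectSum zero_support.
Definition direct_sum_opp u := DirectSum (opp_support u).
Definition direct_sum_add u v := DirectSum (add_support u v).

Fact direct_sum_addA : associative direct_sum_add.
Proof. by move=> u v t; apply: direct_sumP => i; exact: addrA. Qed.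

Fact direct_sum_addC : commutative direct_sum_add.
Proof. by move=> u v; apply: direct_sumP => i; exact: addrC. Qed.

Fact direct_sum_add0 : left_id direct_sum_zero direct_sum_add.
Proof. by move=> u; apply: direct_sumP => i; exact: add0r. Qed.

Fact direct_sum_addN :
  left_inverse direct_sum_zero direct_sum_opp direct_sum_add.
Proof. by move=> u; apply: direct_sumP => i; exact: addNr. Qed.

HB.instance Definition _ := GRing.isZmodule.Build direct_sum
  direct_sum_addA direct_sum_addC direct_sum_add0 direct_sum_addN.

End DirectSum.

(* (+)_i Z_(N i) a_i with the operations of A_lambda: they are computed on    *)
(* integer representatives and then reduced.  When N i.+1 divides N i for all *)
(* i, the result does not depend on the representatives, since a_p a_q only   *)
(* involves the a_k with k >= max(p, q).                                      *)
Section TruncatedRing.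
Variables (lambda : int) (N : nat -> nat).
Local Notation A := (rbring lambda).
Local Notation Q := (direct_sum (fun i => Zmod (N i))).

Fact reduce_support (f : A) :
  finite_support (fun i => \pi_(Zmod (N i)) (rb_coef f i) : Zmod (N i)).
Proof.
apply/asboolP; exists (size (f : {poly int})) => i fi.
by rewrite /rb_coef nth_default //; exact: raddf0.
Qed.

Definition reduce (f : A) : Q := DirectSum (reduce_support f).

Definition lift_sum (u : Q) : A := xget 0 [set f | reduce f = u].

Lemma lift_sumK u : reduce (lift_sum u) = u.
Proof.
rewrite /lift_sum; case: xgetP => [f _ //|noP]; exfalso.
case: (u) noP => c /= cs; case/asboolP: (cs) => n cn.
move=> /(_ (\poly_(i < n) repr (c i))); apply; apply: direct_sumP => i /=.
rewrite /rb_coef coef_poly; case: ltnP => [_|/cn ->]; first by rewrite reprK.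
exact: raddf0.
Qed.

Definition truncated_mul (u v : Q) : Q := reduce (lift_sum u * lift_sum v).

Definition truncated_P (u : Q) : Q := reduce (rbP (lift_sum u)).

Definition quotient_isomorphic (I : set A) (hI : rb_ideal I) : Prop :=
  exists phi : {additive rb_quot hI -> Q},
    [/\ bijective phi,
        forall f g : A, phi (\pi_(rb_quot hI) (f * g)) =
          truncated_mul (phi (\pi_(rb_quot hI) f)) (phi (\pi_(rb_quot hI) g))
      & forall f : A, phi (\pi_(rb_quot hI) (rbP f)) =
          truncated_P (phi (\pi_(rb_quot hI) f))].

End TruncatedRing.

(* The data (s_1, w_1), ..., (s_m, w_m); s 0 and w 0 are fixed by convention, *)
(* and the values beyond index m are irrelevant.                              *)
Definition ascent_data (m : nat) (s w : nat -> nat) : Prop :=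
  [/\ (0 < m)%N, s 0%N = 0%N /\ w 0%N = 0%N,
      forall j, (1 <= j <= m)%N -> (0 < w j)%N
    & forall j, (1 <= j < m)%N ->
        [/\ (s j < s j.+1)%N, w j.+1 <> w j & (w j.+1 %| w j)%N]].

(* The j with s_j <= i < s_(j+1), where s_(m+1) = oo; see blockP.             *)
Definition block (m : nat) (s : nat -> nat) (i : nat) : nat :=
  \max_(j < m.+1 | (s j <= i)%N) j.

Lemma blockP m s w i j : ascent_data m s w -> (j <= m)%N ->
  block m s i = j <-> (s j <= i)%N /\ ((j < m)%N -> (i < s j.+1)%N).
Proof.
move=> [m0 [s0 _] _ hs] jm.
have smono a b : (0 < a <= b)%N -> (b <= m)%N -> (s a <= s b)%N.
  case/andP=> a0; elim: b => [|b IH]; first by rewrite leqNgt a0.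
  rewrite leq_eqVlt => /predU1P[-> //|]; rewrite ltnS => ab bm.
  apply: leq_trans (IH ab (ltnW bm)) _.
  by have [|/ltnW] := hs b; first by rewrite bm (leq_trans a0 ab).
have s_le a b : (a <= b <= m)%N -> (s a <= s b)%N.
  case/andP=> ab bm; case: a ab => [_|a ab]; first by rewrite s0.
  by apply: smono => //; rewrite ab.
split=> [<-|[sji jmax]].
  have [|k sk ek] := @eq_bigmax_cond _ (fun k : 'I_m.+1 => (s k <= i)%N)
      (fun k : 'I_m.+1 => k : nat).
    by apply/card_gt0P; exists ord0; rewrite unfold_in /= s0.
  rewrite /block ek; split=> // km; rewrite ltnNge; apply/negP => sSk.
  have := @leq_bigmax_cond _ (fun k : 'I_m.+1 => (s k <= i)%N)
    (fun k : 'I_m.+1 => k : nat) (Ordinal (km : k.+1 < m.+1)%N) sSk.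
  by rewrite ek /= ltnn.
apply/eqP; rewrite eqn_leq; apply/andP; split; last first.
  exact: (@leq_bigmax_cond _ (fun k : 'I_m.+1 => (s k <= i)%N)
      (fun k : 'I_m.+1 => k : nat) (Ordinal (jm : j < m.+1)%N)).
apply/bigmax_leqP => k ski; rewrite leqNgt; apply/negP => jk.
have km : (k <= m)%N by rewrite -ltnS.
have := jmax (leq_trans jk km); rewrite ltnNge => /negP; apply.
by apply: leq_trans ski; apply: s_le; rewrite jk.
Qed.

Definition modulus (m : nat) (s w : nat -> nat) (i : nat) : nat :=
  w (block m s i).

Definition multiples (w : nat) : set int := [set x | (w%:Z %| x)%Z].

(* (+)_(1 <= j <= m) (+)_(s_j <= i < s_(j+1)) w_j Z a_i as a subset of        *)
(* A_lambda; for i < s_1 the modulus is w_0 = 0 and the coefficient vanishes. *)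
Definition multiples_sum (lambda : int) (m : nat) (s w : nat -> nat) :
    set (rbring lambda) :=
  [set f | forall i, multiples (modulus m s w i) (rb_coef f i)].

Definition complete_representatives (w : nat) (T : set int) : Prop :=
  forall z : int, exists! t, T t /\ multiples w (z - t).

Definition has_underlying_set (lambda : int) (I : set (rbring lambda))
    (m : nat) (s w : nat -> nat) : Prop :=
  forall T : nat -> set int,
    (forall j, (j <= m)%N -> complete_representatives (w j) (T j) /\ T j 0) ->
  forall f : rbring lambda, exists! t : rbring lambda,
    (forall i, T (block m s i) (rb_coef t i)) /\ I (f - t).

(* Main.v *)
(* The index-j leading coefficients of I form a subgroup N_j Z of Z, and      *)
(* applying P gives N_(j+1) | N_j.  Since I <> 0, some N_j is positive, so    *)
(* the chain is eventually constant; its finitely many jumps are the pairs    *)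
(* (s_j, w_j).  Division with remainder by leading terms, from the top degree *)
(* down, yields the unique representatives modulo I, using only the numbers   *)
(* N_j.  As a_p a_q involves only the a_k with k >= max(p, q), every chain of *)
(* divisors N makes (+)_j N_j Z a_j a Rota-Baxter ideal; it equals in(I) in   *)
(* general, and I itself when I is homogeneous, because the elements of I     *)
(* with all their homogeneous components in I form a Rota-Baxter ideal.       *)
From HB Require Import structures.
Require Import Defs.
From mathcomp Require Import all_boot all_order all_algebra.
From mathcomp Require Import all_classical.
From mathcomp Require Import generic_quotient ring_quotient.

Set Implicit Arguments.
Unset Strict Implicit.
Unset Printing Implicit Defensive.

Import Order.TTheory GRing.Theory Num.Theory.
Local Open Scope classical_set_scope.
Local Open Scope ring_scope.
Local Open Scope quotient_scope.

(** The ideal [I] is controlled by one sequence [N] with [Omega I j = multiples (N j)]. Since [rbP]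
    raises the degree by one and keeps the leading coefficient, [N] is a divisor chain
    ([Omega_chain]). It is eventually constant and not identically 0, so finitely many jumps
    describe it: [chain_ascent_data] gives [modulus m s w = N]. The model is [graded N], the
    elements whose i-th coefficient is divisible by [N i]. It equals the initial ideal
    ([initial_ideal_graded]), and [I] itself in the homogeneous case ([homogeneousE]), where
    [graded_quotient] describes the quotient. [division_algorithm] reads normal forms modulo a
    subgroup off its leading coefficients alone, which covers [I], its initial ideal and the
    converse. *)

Lemma int_subgroup_principal (G : set int) :
    G 0 -> (forall x y, G x -> G y -> G (x - y)) ->
  exists n : nat, G = multiples n.
Proof.
move=> G0 GB.
have GN x : G x -> G (- x) by move=> Gx; rewrite -sub0r; exact: GB.
have GD x y : G x -> G y -> G (x + y).
  by move=> Gx Gy; rewrite -[y]opprK; apply: GB => //; exact: GN.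
have GM x z : G x -> G (z * x).
  move=> Gx; have H n : G (n%:Z * x).
    elim: n => [|n IH]; first by rewrite mul0r.
    by rewrite intS mulrDl mul1r; exact: GD.
  by case: z => n; [exact: H | rewrite NegzE mulNr; exact/GN/H].
have [[x Gx x0]|noG] := pselect (exists2 x, G x & x <> 0); last first.
  exists 0%N; apply/seteqP; split=> x /=; rewrite /multiples /= dvd0z.
    by move=> Gx; apply/eqP; apply: contrapT => x0; apply: noG; exists x.
  by move/eqP->.
have exn : exists n, (0 < n)%N && `[< G n%:Z >].
  exists `|x|%N; rewrite absz_gt0; apply/andP; split; first exact/eqP.
  by apply/asboolP; case: (x) Gx => n Gn //; exact: (GN _ Gn).
case: (ex_minnP exn) => n /andP[n0 /asboolP Gn] nmin.
exists n; apply/seteqP; split=> y /=; rewrite /multiples /=; last first.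
  by case/dvdzP=> q ->; exact: GM.
move=> Gy; apply/dvdz_mod0P; have Gr : G (y %% n)%Z.
  by rewrite /modz; apply: GB => //; exact: GM.
have r0 : 0 <= (y %% n)%Z by rewrite modz_ge0 // lt0n_neq0.
have rn : (y %% n)%Z < n by rewrite ltz_pmod.
case: (y %% n)%Z Gr r0 rn => // r Gr _; rewrite ltz_nat => rn.
case: r Gr rn => // r Gr rn.
by have := nmin r.+1; rewrite (asboolT Gr) => /(_ isT); rewrite leqNgt rn.
Qed.

Lemma multiples_sub a b : multiples a `<=` multiples b <-> (b %| a)%N.
Proof.
split=> [ab|ba x]; first exact: (ab a%:Z (dvdzz _)).
by apply: dvdz_trans.
Qed.

(** The value 0 at index 0 mirrors the convention that Omega at -1 is the zero ideal. *)
Definition previous (N : nat -> nat) (t : nat) : nat :=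
  if t is t'.+1 then N t' else 0%N.

(** * From ascent data to a divisor chain *)

Section AscentData.
Variables (m : nat) (s w : nat -> nat).
Hypothesis sw : ascent_data m s w.

Lemma block_le i : (block m s i <= m)%N.
Proof. by apply/bigmax_leqP => k _; rewrite -ltnS. Qed.

Lemma block_geq i j : (j <= m)%N -> (s j <= i)%N -> (j <= block m s i)%N.
Proof.
rewrite -ltnS => jm ji.
exact: (@leq_bigmax_cond _ (fun k : 'I_m.+1 => (s k <= i)%N)
  (fun k : 'I_m.+1 => k : nat) (Ordinal jm)).
Qed.

Lemma ascent_dvd a b : (a <= b <= m)%N -> (w b %| w a)%N.
Proof.
have [_ [_ w0] _ sS] := sw.
(* [ascent_data] relates only indices from 1 on; index 0 is covered because everything divides
   [w 0 = 0]. *)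
case/andP; case: a => [|a]; first by rewrite w0 dvdn0.
elim: b => // b IH; rewrite leq_eqVlt => /predU1P[->//|ab bm].
apply: dvdn_trans (IH ab (ltnW bm)).
by case: b ab bm {IH} => // b ab bm; have [] := sS b.+1 bm.
Qed.

Lemma modulus_dvd i : (modulus m s w i.+1 %| modulus m s w i)%N.
Proof.
apply: ascent_dvd; rewrite block_le andbT; apply: block_geq; first exact: block_le.
by apply/leqW; have [/(_ erefl)[]] := @blockP m s w i _ sw (block_le i).
Qed.

End AscentData.

(** * From a divisor chain to its jumps *)

Section DivisorChain.
Variable N : nat -> nat.
Hypothesis N_dvd : forall i, (N i.+1 %| N i)%N.

Lemma chain_dvd a b : (a <= b)%N -> (N b %| N a)%N.
Proof.
elim: b => [|b IH]; first by rewrite leqn0 => /eqP->.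
by rewrite leq_eqVlt => /predU1P[->//|/IH]; exact: dvdn_trans.
Qed.

(** After a nonzero entry, each new value is a proper divisor, hence smaller and again nonzero;
    induction on the value ends. *)
Lemma chain_stationary : exists K, forall i, (K <= i)%N -> N i = N K.
Proof.
have [N0|/existsNP[k /eqP Nk]] := pselect (forall i, N i = 0%N).
  by exists 0%N => i _; rewrite !N0.
have [v] := ubnP (N k); elim: v k Nk => // v IH k Nk; rewrite ltnS => Nv.
have [st|/existsNP[i /not_implyP[ki /eqP Nik]]] :=
  pselect (forall i, (k <= i)%N -> N i = N k); first by exists k.
have Ni : (N i < N k)%N.
  by rewrite ltn_neqAle Nik dvdn_leq ?lt0n // chain_dvd.
apply: (IH i); last exact: leq_trans Ni Nv.
apply: contra Nk => /eqP Ni0; have := chain_dvd ki.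
by rewrite Ni0 dvd0n.
Qed.

Lemma jump_pos t : previous N t <> N t -> (0 < N t)%N.
Proof.
case: t => [|t] /=; first by rewrite lt0n => /nesym/eqP.
rewrite lt0n => Nt; apply/eqP => Nt0; apply: Nt; rewrite Nt0.
by have := N_dvd t; rewrite Nt0 dvd0n => /eqP.
Qed.

Lemma no_jump a b : (a <= b)%N ->
  (forall t, (a < t <= b)%N -> previous N t = N t) -> N b = N a.
Proof.
elim: b => [|b IH]; first by rewrite leqn0 => /eqP->.
rewrite leq_eqVlt => /predU1P[->//|ab] nj.
rewrite -(nj b.+1) ?leqnn ?andbT //= IH // => t /andP[a_t tb].
by apply: nj; rewrite a_t leqW.
Qed.

(** The chain is constant between consecutive jumps, so their positions and the values there
    determine it. No jump occurs beyond [K], hence the finite increasing list [S]. *)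
Lemma chain_ascent_data : (exists i, N i <> 0%N) ->
  exists m s w, [/\ ascent_data m s w, modulus m s w = N,
    [set t | previous N t <> N t] = [set s j | j in [set j | (1 <= j <= m)%N]]
    & forall j, (1 <= j <= m)%N -> w j = N (s j)].
Proof.
case=> k Nk; have [K NK] := chain_stationary.
pose jump t := previous N t != N t.
pose S := [seq t <- iota 0 K.+1 | jump t].
(* [S] is re-indexed from 1, which leaves index 0 for the convention [s 0 = w 0 = 0]. *)
pose s j := if j is j'.+1 then nth 0%N S j' else 0%N.
pose w j := if j is _.+1 then N (s j) else 0%N.
have jumpS t : jump t -> t \in S.
  move=> jt; rewrite mem_filter jt mem_iota ltnS /=.
  case: leqP => // Kt; move: jt Kt; rewrite /jump; case: t => //= t.
  by rewrite ltnS => /eqP jt Kt; case: jt; rewrite !NK // leqW.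
have sS j : (1 <= j <= size S)%N -> s j \in S.
  by case: j => // j; rewrite /s => ?; exact: mem_nth.
have s_jump j : (1 <= j <= size S)%N -> jump (s j).
  by move/sS; rewrite mem_filter => /andP[].
have jumpP t : jump t -> exists2 j, (1 <= j <= size S)%N & s j = t.
  move/jumpS => St; exists (index t S).+1; first by rewrite /= index_mem.
  exact: nth_index.
have Ssorted : sorted ltn S.
  by apply: sorted_filter (iota_ltn_sorted 0 K.+1); exact: ltn_trans.
have s_lt j : (1 <= j < size S)%N -> (s j < s j.+1)%N.
  case: j => // j /= jS.
  by apply: (sorted_ltn_nth ltn_trans) => //; rewrite inE // ltnW.
(* Without jumps, not even at 0, the chain would vanish identically. *)
have m0 : (0 < size S)%N.
  rewrite lt0n; apply/negP => /nilP S0.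
  have nj t : ~~ jump t.
    by apply/negP => /jumpS; rewrite S0.
  apply: Nk; rewrite (@no_jump 0 k) // => [|t _]; apply/eqP; last first.
    by have := nj t; rewrite negbK.
  by have := nj 0%N; rewrite negbK eq_sym.
have data : ascent_data (size S) s w.
  split=> // [[//|j] jS|j jS].
    by apply/jump_pos/eqP; exact: s_jump.
  have lt_j := s_lt j jS; split=> //.
  - have jS' : (1 <= j.+1 <= size S)%N by case/andP: jS.
    have := s_jump _ jS'; rewrite /jump /w.
    case: j jS lt_j {jS'} => // j _; case: (s j.+2) => //= t lt_t /eqP jt e.
    (* The later jump is at [t.+1], and [N t] divides the value at the earlier one. If that value
       were [N t.+1], then [N t] and [N t.+1] would divide each other and there would be no jump. *)
    apply: jt; apply/eqP; rewrite eqn_dvd N_dvd andbT [X in (_ %| X)%N]e.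
    exact: chain_dvd.
  - by case: j jS lt_j => // j _ lt_j; apply: chain_dvd; exact: ltnW.
exists (size S), s, w; split=> //.
- apply: funext => i; rewrite /modulus; set j := block _ _ _.
  have jm : (j <= size S)%N := block_le _ _ _.
  have [/(_ erefl)[ji _] _] := @blockP _ _ _ i _ data jm.
  (* Every jump up to [i] is at most [s j], and there is none when [j] is 0; so [N] is constant from
     [s j] to [i]. *)
  have jmax t : jump t -> (t <= i)%N -> (0 < j)%N /\ (t <= s j)%N.
    case/jumpP => l /andP[l0 lS] <- li; have lj := block_geq lS li.
    split; first exact: leq_trans l0 lj.
    have : (l <= j <= size S)%N by rewrite lj.
    case/andP; elim: (j) => [|b IH]; first by rewrite leqn0 => /eqP->.
    rewrite leq_eqVlt => /predU1P[->//|lb bS].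
    by apply: leq_trans (IH lb (ltnW bS)) (ltnW (s_lt b _)); rewrite bS (leq_trans l0 lb).
  have noj t : ((0 < j)%N -> (s j < t)%N) -> (t <= i)%N -> previous N t = N t.
    move=> jt ti; apply/eqP; apply: contraT => /jmax -/(_ ti)[/jt].
    by rewrite ltnNge => /negP.
  case: (j) ji noj => [|j'] ji noj.
    rewrite (@no_jump 0 i) // => [|t /andP[_ ti]]; last exact: noj.
    exact: (noj 0%N).
  by rewrite [RHS](@no_jump _ i ji) // => t /andP[jt ti]; exact: noj.
- apply/seteqP; split=> t /=; first by move/eqP/jumpP => [j ? ?]; exists j.
  by case=> j /s_jump /eqP jt <-.
- by case.
Qed.

End DivisorChain.

(** * Coefficients, leading coefficients and division in A_lambda *)

Section Ideals.
Variable lambda : int.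
Local Notation A := (rbring lambda).

Lemma rb_coefB (f g : A) i : rb_coef (f - g) i = rb_coef f i - rb_coef g i.
Proof. exact: coefB. Qed.

Lemma rb_coef_basisMz n z i :
  rb_coef (basis lambda n *~ z) i = if i == n then z else 0.
Proof.
have -> : (basis lambda n *~ z : A) = z *: ('X^n : {poly int}).
  by rewrite -[in RHS](intz z) scaler_int.
by rewrite /rb_coef coefZ coefXn; case: eqP; rewrite ?mulr1 ?mulr0.
Qed.

Lemma rb_coef_out (f : A) i : (size (f : {poly int}) <= i)%N -> rb_coef f i = 0.
Proof. exact: nth_default. Qed.

Lemma size_leP (f : A) n :
  (forall i, (n <= i)%N -> rb_coef f i = 0) -> (size (f : {poly int}) <= n)%N.
Proof. by move=> f0; apply/leq_sizeP. Qed.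

Lemma rb_coef_lead (f : A) : f <> 0 ->
  rb_coef f (size (f : {poly int})).-1 <> 0.
Proof. by move=> f0; apply/eqP; rewrite [_ == _]lead_coef_eq0; exact/eqP. Qed.

Lemma size_gt0 (f : A) : f <> 0 -> (0 < size (f : {poly int}))%N.
Proof. by move=> f0; rewrite size_poly_gt0; exact/eqP. Qed.

Lemma rb_coef_rbP (f : A) i :
  rb_coef (rbP f) i = if i is i'.+1 then rb_coef f i' else 0.
Proof. by rewrite /rb_coef /rbP coefXM; case: i. Qed.

Lemma rbP_basisMz n z :
  rbP (basis lambda n *~ z) = basis lambda n.+1 *~ z.
Proof. by rewrite rbP_Mz rbP_basis. Qed.

Lemma subset_neq0 (I : set A) : I 0 -> I <> [set 0] -> exists2 f, I f & f <> 0.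
Proof.
move=> I0 In0; apply: contrapT => noI; apply: In0; apply/seteqP.
split=> [f If|_ -> //]; apply: contrapT => f0; by apply: noI; exists f.
Qed.

Section Subgroup.
Variable K : set A.
Hypothesis K0 : K 0.
Hypothesis KB : forall f g, K f -> K g -> K (f - g).

Lemma subgroupN f : K f -> K (- f).
Proof. by move=> Kf; rewrite -sub0r; exact: KB. Qed.

Lemma subgroupD f g : K f -> K g -> K (f + g).
Proof. by move=> Kf Kg; rewrite -[g]opprK; apply: KB => //; exact: subgroupN. Qed.

Lemma subgroupMz f z : K f -> K (f *~ z).
Proof.
move=> Kf; have H n : K (f *+ n).
  by elim: n => [|n IH]; rewrite ?mulr0n // mulrS; exact: subgroupD.
by case: z => n; rewrite ?NegzE ?mulrNz -pmulrn //; exact: subgroupN.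
Qed.

Lemma subgroup_sum (f : A) :
  (forall i, K (basis lambda i *~ rb_coef f i)) -> K f.
Proof. by move=> Kf; rewrite (basisE f); apply: big_ind => // *; exact: subgroupD. Qed.

(* The product a_p a_q only involves the a_k with k >= q. *)
Lemma subgroup_mul (g : A) :
    (forall q k, (q <= k)%N -> K (basis lambda k *~ rb_coef g q)) ->
  forall f, K (f * g).
Proof.
move=> Kg f; elim/basis_ind: f => [|f f' Hf Hf'|f Hf|p].
- by rewrite mul0r.
- by rewrite mulrDl; exact: subgroupD.
- by rewrite mulNr; exact: subgroupN.
rewrite [X in _ * X]basisE mulr_sumr.
apply: big_ind => // [f f' Kf Kf'|q _]; first exact: subgroupD.
rewrite mulrzAr rbring_mulE /basis_mul mulrz_suml.
apply: big_ind => // [f f' Kf Kf'|i _]; first exact: subgroupD.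
rewrite mulrzAC; apply/subgroupMz/Kg.
have ip : (i <= p)%N by rewrite -ltnS (leq_trans (ltn_ord i)) // ltnS geq_minl.
by rewrite -addnBAC // leq_addl.
Qed.

(* Leading coefficients, with the leading term allowed to vanish. *)
Lemma OmegaP j b : Omega K j b <->
  exists f, [/\ K f, (size (f : {poly int}) <= j.+1)%N & rb_coef f j = b].
Proof.
split=> [[->|[f [Kf f0 fb]]]|[f [Kf fj <-]]].
- by exists 0; split; rewrite ?size_poly0 ?rb_coef_out ?size_poly0.
- have fn0 := rb_coef_lead f0.
  have /(congr1 (fun g => rb_coef g (size (f : {poly int})).-1)) := fb.
  rewrite /initial !rb_coef_basisMz eqxx.
  case: eqP => [jE e|]; last by move=> _ /fn0.
  by exists f; split=> //; rewrite -jE // prednK ?size_gt0.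
- have [->|/eqP fj0] := eqVneq (rb_coef f j) 0; first by left.
  have f0 : f <> 0 by move=> f0; apply: fj0; rewrite f0 rb_coef_out ?size_poly0.
  right; exists f; split=> //; rewrite /initial.
  suff -> : (size (f : {poly int})).-1 = j by [].
  apply/eqP; rewrite eqn_leq -ltnS prednK ?size_gt0 // fj -ltnS prednK ?size_gt0 //.
  by rewrite ltnNge; apply/negP => /rb_coef_out/fj0.
Qed.

Lemma Omega_principal j : exists n, Omega K j = multiples n.
Proof.
apply: int_subgroup_principal; first by left.
move=> x y /OmegaP[f [Kf fj <-]] /OmegaP[g [Kg gj <-]]; apply/OmegaP.
exists (f - g); split; [exact: KB| |exact: rb_coefB].
apply: size_leP => i ji; rewrite rb_coefB !rb_coef_out ?subr0 //.
  exact: leq_trans ji.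
exact: leq_trans ji.
Qed.

(** Existence goes down from the top degree, correcting one coefficient at a time by an element of
    [K]. For uniqueness, the difference of two normal forms lies in [K], so its leading coefficient
    is a multiple of [N n]; the two representatives in degree [n] then agree, and that coefficient
    is 0. *)
Lemma division_algorithm (T : nat -> set int) (N : nat -> nat) (f : A) :
    (forall j, Omega K j = multiples (N j)) ->
    (forall j, complete_representatives (N j) (T j)) -> (forall j, T j 0) ->
  exists! t : A, (forall i, T i (rb_coef t i)) /\ K (f - t).
Proof.
move=> OK TN T0.
have [t [Tt Kt]] : exists t : A, (forall i, T i (rb_coef t i)) /\ K (f - t).
  suff H n (g : A) : (size (g : {poly int}) <= n)%N -> exists t : A,
      [/\ (forall i, T i (rb_coef t i)), K (g - t) &
          (size (t : {poly int}) <= n)%N].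
    by have [t [? ? _]] := H _ f (leqnn _); exists t.
  elim: n g => [|n IH] g gn.
    exists 0; split; rewrite ?size_poly0 //.
    - by move=> i; rewrite rb_coef_out ?size_poly0.
    - by move: gn; rewrite size_poly_leq0 => /eqP ->; rewrite subr0.
  have [c [[Tc]]] := TN n (rb_coef g n).
  rewrite -OK => /OmegaP[h [Kh hn hc]] _.
  (* Subtracting [h] turns the coefficient of degree [n] into its representative [c]; removing that
     term lowers the size for the induction. *)
  pose g' : A := g - h - basis lambda n *~ c.
  have [|t [Tt Kt tn]] := IH g'.
    apply: size_leP => i; rewrite leq_eqVlt !rb_coefB rb_coef_basisMz.
    case/predU1P => [<-|ni]; first by rewrite eqxx hc subKr subrr.
    by rewrite (gtn_eqF ni) !rb_coef_out ?subrr // (leq_trans _ ni).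
  have tc i : rb_coef (t + basis lambda n *~ c) i =
      if i == n then c else rb_coef t i.
    rewrite rb_coefD rb_coef_basisMz; case: eqP => [->|_]; last by rewrite addr0.
    by rewrite rb_coef_out ?add0r.
  exists (t + basis lambda n *~ c); split=> [i| |].
  - by rewrite tc; case: eqP => [->|].
  - have -> : g - (t + basis lambda n *~ c) = (g' - t) + h.
      rewrite /g' -!addrA; congr (_ + _).
      by rewrite opprD [RHS]addrC -!addrA addrN addr0 addrC.
    exact: subgroupD.
  - apply: size_leP => i ni; rewrite tc gtn_eqF // rb_coef_out //.
    exact: leq_trans tn (ltnW ni).
exists t; split=> // t' [Tt' Kt'].
have Kd : K (t - t').
  have -> : t - t' = (f - t') - (f - t) by rewrite opprB [RHS]addrC subrKA.
  exact: KB.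
apply: contrapT => tt'; have {tt'}d0 : t - t' <> 0 by move/subr0_eq.
set d := t - t' in Kd d0.
have dn0 := rb_coef_lead d0; set n := (size _).-1 in dn0.
apply: dn0; rewrite rb_coefB; apply/eqP; rewrite subr_eq0; apply/eqP.
have [c [_ cuniq]] := TN n (rb_coef t n).
rewrite -(cuniq (rb_coef t n)) ?(cuniq (rb_coef t' n)) //; split=> //.
- rewrite -rb_coefB -OK; apply/OmegaP; exists d; split=> //.
  by rewrite prednK ?size_gt0.
- by rewrite /multiples /= subrr dvdz0.
Qed.

End Subgroup.

(** * Graded ideals of divisor chains *)

Section GradedIdeal.
Variable N : nat -> nat.

(** For [N := modulus m s w] this is [multiples_sum m s w] by conversion. *)
Definition graded : set A := [set f | forall i, multiples (N i) (rb_coef f i)].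

Lemma graded_basis n z : multiples (N n) z -> graded (basis lambda n *~ z).
Proof.
move=> Nz i; rewrite rb_coef_basisMz; case: eqP => [->//|_].
exact: dvdz0.
Qed.

Hypothesis N_dvd : forall i, (N i.+1 %| N i)%N.

(** Products and [rbP] carry a coefficient of index [q] only to indices [k >= q], where [N k]
    divides [N q]. *)
Lemma graded_ideal : rb_ideal graded.
Proof.
have G0 : graded 0.
  by move=> i; rewrite rb_coef_out ?size_poly0 //; exact: dvdz0.
have GB f g : graded f -> graded g -> graded (f - g).
  by move=> Gf Gg i; rewrite rb_coefB; apply: rpredB; [exact: Gf|exact: Gg].
split=> // [f g Gg|f Gf i].
  apply: subgroup_mul => // q k qk; apply: graded_basis.
  by have /multiples_sub := chain_dvd N_dvd qk; apply; exact: Gg.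
rewrite rb_coef_rbP; case: i => [|i]; first exact: dvdz0.
by have /multiples_sub := N_dvd i; apply; exact: Gf.
Qed.

Lemma Omega_graded j : Omega graded j = multiples (N j).
Proof.
have [G0 _ _ _] := graded_ideal.
apply/seteqP; split=> b; first by case/(OmegaP G0) => f [Gf _ <-].
move=> Nb; apply/(OmegaP G0); exists (basis lambda j *~ b).
split; [exact: graded_basis| |by rewrite rb_coef_basisMz eqxx].
by apply: size_leP => i ji; rewrite rb_coef_basisMz gtn_eqF.
Qed.

End GradedIdeal.

(** * Rota-Baxter ideals and their leading coefficients *)

Section RBIdeal.
Variable I : set A.
Hypothesis hI : rb_ideal I.

Lemma Omega_leS j : Omega I j `<=` Omega I j.+1.
Proof.
have [I0 _ _ IP] := hI => b /(OmegaP I0)[f [If fj <-]]; apply/(OmegaP I0).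
exists (rbP f); split; [exact: IP| |by rewrite rb_coef_rbP].
by apply: size_leP => -[//|i] ji; rewrite rb_coef_rbP rb_coef_out // (leq_trans fj).
Qed.

Lemma rb_ideal_basis b q k : (q <= k)%N ->
  I (basis lambda q *~ b) -> I (basis lambda k *~ b).
Proof.
have [_ _ _ IP] := hI => qk Iq; rewrite -(subnK qk).
elim: (k - q)%N => // n IH; rewrite addSn -rbP_basisMz; exact: IP.
Qed.

(** The set [J] of elements with all components in [I] is a Rota-Baxter ideal containing the
    homogeneous generators, so it contains [I]. *)
Lemma homogeneous_graded : homogeneous I ->
  forall f, I f -> forall i, I (basis lambda i *~ rb_coef f i).
Proof.
have [I0 IB IM IP] := hI; case=> X [Xhom IX].
pose J : set A := [set f | forall i, I (basis lambda i *~ rb_coef f i)].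
have J0 : J 0 by move=> i; rewrite rb_coef_out ?size_poly0 ?mulr0z.
have JB f g : J f -> J g -> J (f - g).
  by move=> Jf Jg i; rewrite rb_coefB mulrzBr; exact: IB.
have Jbasis n b : I (basis lambda n *~ b) -> J (basis lambda n *~ b).
  move=> Inb i; rewrite rb_coef_basisMz; case: eqP => [->//|_].
  by rewrite mulr0z.
have Jideal : rb_ideal J.
  split=> // [f g Jg|f Jf [|i]].
  - apply: subgroup_mul => // q k qk; apply: Jbasis.
    exact: rb_ideal_basis (Jg q).
  - by rewrite rb_coef_rbP mulr0z.
  - by rewrite rb_coef_rbP -rbP_basisMz; exact: IP.
move=> f; rewrite {1}IX => /(_ J Jideal); apply=> g Xg.
have [b [n e]] := Xhom g Xg; rewrite e; apply: Jbasis; rewrite -e IX.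
exact: sub_rb_generated.
Qed.

Variable N : nat -> nat.
Hypothesis OmegaN : forall j, Omega I j = multiples (N j).

Lemma Omega_chain i : (N i.+1 %| N i)%N.
Proof. by apply/multiples_sub; rewrite -!OmegaN; exact: Omega_leS. Qed.

Lemma Omega_neq0 : I <> [set 0] -> exists i, N i <> 0%N.
Proof.
have [I0 _ _ _] := hI => /(subset_neq0 I0)[f If f0].
exists (size (f : {poly int})).-1 => Nf.
have : Omega I (size (f : {poly int})).-1 (rb_coef f (size (f : {poly int})).-1).
  by apply/(OmegaP I0); exists f; rewrite prednK ?size_gt0.
rewrite OmegaN Nf /multiples /= dvd0z => /eqP; exact: rb_coef_lead.
Qed.

(** Initial terms lie in the Rota-Baxter ideal [graded N]; conversely, each component of an element
    of [graded N] is zero or the initial term of an element of [I]. *)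
Lemma initial_ideal_graded : initial_ideal I = graded N.
Proof.
have [I0 _ _ _] := hI; have [i0 iB _ _] := rb_generated_ideal
  [set initial f | f in [set f | I f /\ f <> 0]].
apply/seteqP; split=> [f /(_ _ (graded_ideal Omega_chain))|f Nf].
  apply=> _ [g [Ig g0] <-]; apply: graded_basis; rewrite -OmegaN; right.
  by exists g.
apply: subgroup_sum => // i; have := Nf i; rewrite -OmegaN => -[->|].
  by rewrite mulr0z.
by case=> g [Ig g0 <-]; apply: sub_rb_generated; exists g.
Qed.

Lemma homogeneousE : homogeneous I -> I = graded N.
Proof.
move=> /homogeneous_graded Ihom; have [I0 IB _ _] := hI.
apply/seteqP; split=> f If.
  move=> i; rewrite -OmegaN; apply/(OmegaP I0).
  exists (basis lambda i *~ rb_coef f i); split; first exact: Ihom.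
    by apply: size_leP => k ik; rewrite rb_coef_basisMz gtn_eqF.
  by rewrite rb_coef_basisMz eqxx.
(* The coefficient is that of some [g] in [I], and homogeneity puts the corresponding component of
   [g] back into [I]. *)
apply: subgroup_sum => // i; have := If i; rewrite -OmegaN.
by case/(OmegaP I0) => g [Ig _ <-]; exact: Ihom.
Qed.

(** A natural number is determined by its multiples, so strict growth of [Omega] means a change in
    the value of [N]. *)
Lemma ascent_setE : ascent_set I =
  [set (t, multiples (N t)) | t in [set t | previous N t <> N t]].
Proof.
rewrite /ascent_set; have -> : Omega I = fun t => multiples (N t).
  exact/funext/OmegaN.
have predE t : Omega_pred I t = multiples (previous N t).
  case: t => //=; apply/seteqP; split=> x; rewrite /multiples /= dvd0z; last by move/eqP.
  by move=> ->.
have leN t : multiples (previous N t) `<=` multiples (N t).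
  by apply/multiples_sub; case: t => [|t]; rewrite ?dvdn0 //=; exact: Omega_chain.
apply/seteqP; split=> _ [t /= jt <-]; exists t => //=; rewrite ?predE.
  by move=> e; move: jt; rewrite predE e => -[_]; apply.
split=> // /multiples_sub Nt; apply: jt; apply/eqP.
by rewrite eqn_dvd Nt; have /multiples_sub -> := leN t.
Qed.

End RBIdeal.

End Ideals.

(** * Reduction modulo a graded ideal *)

Section Quotient.
Variables (lambda : int) (N : nat -> nat).
Local Notation A := (rbring lambda).

Lemma Zmod_eqP n (a b : int) :
  \pi_(Zmod n) a = \pi_(Zmod n) b <-> multiples n (a - b).
Proof.
by split=> [/eqP|ab]; [rewrite -Quotient.idealrBE|apply/eqP; rewrite -Quotient.idealrBE].
Qed.

Lemma reduce_eqP (f g : A) : reduce N f = reduce N g <-> graded N (f - g).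
Proof.
split=> [/(congr1 val) e i|fg].
  rewrite rb_coefB; apply/Zmod_eqP.
  exact: (congr1 (fun u : forall i, Zmod (N i) => u i) e).
by apply: direct_sumP => i; apply/Zmod_eqP; rewrite -rb_coefB; exact: fg.
Qed.

Lemma reduceB : zmod_morphism (reduce N : A -> _).
Proof.
move=> f g; apply: direct_sumP => i.
by rewrite /= rb_coefB raddfB.
Qed.

Hypothesis N_dvd : forall i, (N i.+1 %| N i)%N.

(** Lifting a reduced factor changes it by an element of the ideal [graded N]; the factors are
    exchanged one at a time. *)
Lemma reduce_mul (f g : A) :
  reduce N (f * g) = truncated_mul lambda (reduce N f) (reduce N g).
Proof.
have [_ _ GM _] := graded_ideal lambda N_dvd.
have GMr f' g' : graded N f' -> graded N (f' * g' : A).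
  by rewrite mulrC; exact: GM.
have Glift (h : A) : graded N (h - lift_sum lambda (reduce N h)).
  by apply/reduce_eqP; rewrite lift_sumK.
rewrite /truncated_mul; set f' := lift_sum _ _; set g' := lift_sum _ (reduce N g).
transitivity (reduce N (f' * g)); apply/reduce_eqP.
  by rewrite -mulrBl; exact: GMr.
by rewrite -mulrBr; exact: GM.
Qed.

Lemma reduce_P (f : A) : reduce N (rbP f) = truncated_P lambda (reduce N f).
Proof.
have [_ _ _ GP] := graded_ideal lambda N_dvd.
apply/reduce_eqP; rewrite -raddfB; apply: GP.
by apply/reduce_eqP; rewrite lift_sumK.
Qed.

(** First isomorphism theorem for [reduce N]: its kernel is [graded N], and [lift_sum] is a section
    of it. *)
Lemma graded_quotient (I : set A) (hI : rb_ideal I) :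
  I = graded N -> quotient_isomorphic N hI.
Proof.
move=> IN; have quot_eqP (f g : A) :
    \pi_(rb_quot hI) f = \pi_(rb_quot hI) g <-> reduce N f = reduce N g.
  rewrite reduce_eqP -IN; split=> [/eqP|fg].
    by rewrite -Quotient.idealrBE => /asboolP.
  by apply/eqP; rewrite -Quotient.idealrBE; exact/asboolP.
pose phi (x : rb_quot hI) := reduce N (repr x).
have phi_pi f : phi (\pi_(rb_quot hI) f) = reduce N f.
  by apply/quot_eqP; rewrite reprK.
have phiB : zmod_morphism phi.
  move=> x y; rewrite -[x]reprK -[y]reprK -raddfB !phi_pi; exact: reduceB.
exists (HB.pack_for {additive rb_quot hI -> direct_sum (fun i => Zmod (N i))}
  phi (GRing.isZmodMorphism.Build _ _ phi phiB)).
split=> /= [|f g|f].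
- exists (fun u => \pi_(rb_quot hI) (lift_sum lambda u)) => [x|u].
    by rewrite -[RHS]reprK; apply/quot_eqP; rewrite lift_sumK.
  by rewrite phi_pi lift_sumK.
- by rewrite !phi_pi reduce_mul.
- by rewrite !phi_pi reduce_P.
Qed.

End Quotient.

Theorem theorem4p1 (lambda : int) :
  (forall (I : set (rbring lambda)) (hI : rb_ideal I), I <> [set 0] ->
     exists (m : nat) (s w : nat -> nat),
       [/\ ascent_data m s w,
           ascent_set I =
             [set (s j, multiples (w j)) | j in [set j | (1 <= j <= m)%N]],
           homogeneous I ->
             I = multiples_sum m s w /\
             quotient_isomorphic (modulus m s w) hI
         & ~ homogeneous I ->
             has_underlying_set I m s w /\
             has_underlying_set (initial_ideal I) m s w])
  /\
  (forall (m : nat) (s w : nat -> nat), ascent_data m s w ->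
     exists I : set (rbring lambda), rb_ideal I /\ has_underlying_set I m s w).
Proof.
have underlying (K : set (rbring lambda)) m s w : rb_ideal K ->
    (forall j, Omega K j = multiples (modulus m s w j)) ->
    has_underlying_set K m s w.
  case=> K0 KB _ _ KO T TP f.
  (* Composing with [block m s] turns representatives chosen per block into representatives per
     degree. *)
  by apply: (division_algorithm K0 KB (T := T \o block m s) f KO) => j;
    have [] := TP _ (block_le m s j).
split=> [I hI In0|m s w sw]; last first.
  have hG := graded_ideal lambda (modulus_dvd sw).
  exists (multiples_sum m s w); split=> //; apply: underlying => // j.
  exact: Omega_graded (modulus_dvd sw) j.
have [I0 IB _ _] := hI.
have [N IN] := choice (Omega_principal I0 IB).
have N_dvd := Omega_chain hI IN.
have [m [s [w [sw sN jumps wN]]]] := chain_ascent_data N_dvd (Omega_neq0 hI IN In0).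
exists m, s, w; split=> //.
- rewrite (ascent_setE hI IN) jumps image_comp.
  by apply: eq_imagel => j /= jm; rewrite wN.
- move=> /(homogeneousE hI IN) IE; split; first by rewrite IE -sN.
  by rewrite sN; exact: graded_quotient.
move=> _; split; apply: underlying; rewrite ?sN //.
  exact: rb_generated_ideal.
(* The initial ideal has the same leading coefficients as [I], hence the same normal forms. *)
by move=> j; rewrite (initial_ideal_graded hI IN) Omega_graded.
Qed.
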